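(* Consider a hierarchical tensor factorization with mode tree $\mathcal T$ over $[N]$, numbers $(R_\nu)_{\nu\in\mathrm{int}(\mathcal T)}$, and weight matrices $(W^{(\nu)}(t))_{\nu\in\mathcal T}$ evolving under gradient flow on $\phi_H$ for $t\ge 0$. Assume the unbalancedness magnitude at initialization ($t=0$) is zero. Then for every $\nu\in\mathrm{int}(\mathcal T)$, $r\in[R_\nu]$ and $t\ge 0$: $$\frac{d}{dt}\sigma_{\nu,r}(t)=\sigma_{\nu,r}(t)^{2-\frac{2}{L_\nu}}\,L_\nu\,\big\langle -\nabla\mathcal L_H(\mathcal W_H(t)),\,\mathcal E_{\nu,r}(t)\big\rangle,$$ where $L_\nu:=|C(\nu)|+1$ is the number of weight vectors in a local component at $\nu$.
   Context: Fix $N\in\mathbb N$, $D_1,\dots,D_N\in\mathbb N$; $[K]:=\{1,\dots,K\}$. Norms are Frobenius norms, $\langle\cdot,\cdot\rangle$ the entrywise inner product, $\otimes$ the tensor (outer) product. A mode tree $\mathcal T$ over $[N]$ is a rooted tree whose nodes are labeled by subsets of $[N]$, with exactly $N$ leaves labeled $\{1\},\dots,\{N\}$, and where each interior node's label is the union of its children's labels; nodes are identified with labels, the root is $[N]$, $\mathrm{int}(\mathcal T)$ denotes interior nodes, $Pa(\nu)$ the parent, $C(\nu)$ the children (in a fixed order). A hierarchical tensor factorization is given by $R_\nu\in\mathbb N$ ($\nu\in\mathrm{int}(\mathcal T)$), with conventions $R_{Pa([N])}:=1$, $R_{\{n\}}:=D_n$, and weight matrices $W^{(\nu)}\in\mathbb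 R^{R_\nu\times R_{Pa(\nu)}}$, $\nu\in\mathcal T$. Intermediate tensors: for leaves, $\mathcal W^{(\{n\},r)}:=W^{(\{n\})}_{:,r}$, $r\in[R_{Pa(\{n\})}]$; for $\nu\in\mathrm{int}(\mathcal T)\setminus\{[N]\}$ (from leaves to root) and $r\in[R_{Pa(\nu)}]$, $\mathcal W^{(\nu,r)}:=\pi_\nu\big(\sum_{r'=1}^{R_\nu}W^{(\nu)}_{r',r}\bigotimes_{\nu_c\in C(\nu)}\mathcal W^{(\nu_c,r')}\big)$; the end tensor is $\mathcal W_H:=\pi_{[N]}\big(\sum_{r'=1}^{R_{[N]}}W^{([N])}_{r',1}\bigotimes_{\nu_c\in C([N])}\mathcal W^{(\nu_c,r')}\big)\in\mathbb R^{D_1\times\cdots\times D_N}$. Here $\pi_\nu$ permutes the modes of its input (whose modes correspond, in order, to the elements of the first child in ascending order, then of the second child, etc.) so that they appear in ascending order of the elements of $\nu$. For $\nu\in\mathrm{int}(\mathcal T)$, $r\in[R_\nu]$, $\mathrm{LC}(\nu,r)$ is the collection of vectors $W^{(\nu)}_{r,:}$ and $W^{(\nu_c)}_{:,r}$ ($\nu_c\in C(\nu)$); the $(\nu,r)$'th local component is $W^{(\nu)}_{r,:}\otimes\bigotimes_{\nu_c\in C(\nu)}W^{(\nu_c)}_{:,r}$ and its norm is $\sigma_{\nu,r}:=\prod_{w\in\mathrm{LC}(\nu,r)}\|w\|$. $\mathcal E_{\nu,r}$ denotes the end tensor obtained from the same construction except that, for every $r'\in[R_{Pa(\nu)}]$,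 the tensor produced at node $\nu$ (the end tensor itself if $\nu=[N]$, with $r'=1$) is replaced by $\pi_\nu\big(\sigma_{\nu,r}^{-1}W^{(\nu)}_{r,r'}\bigotimes_{\nu_c\in C(\nu)}\mathcal W^{(\nu_c,r)}\big)$; by convention $\mathcal E_{\nu,r}:=0$ if $\sigma_{\nu,r}=0$. Let $\mathcal L_H:\mathbb R^{D_1\times\cdots\times D_N}\to\mathbb R_{\ge0}$ be differentiable and locally smooth (its gradient is Lipschitz on every compact set), $\phi_H((W^{(\nu)})_{\nu\in\mathcal T}):=\mathcal L_H(\mathcal W_H)$, and gradient flow means $\frac{d}{dt}W^{(\nu)}(t)=-\frac{\partial}{\partial W^{(\nu)}}\phi_H((W^{(\nu')}(t))_{\nu'\in\mathcal T})$ for all $\nu\in\mathcal T$, $t\ge0$; $\mathcal W_H(t),\sigma_{\nu,r}(t),\mathcal E_{\nu,r}(t)$ are computed from the weights at time $t$. The unbalancedness magnitude is $\max_{\nu\in\mathrm{int}(\mathcal T),r\in[R_\nu],w,w'\in\mathrm{LC}(\nu,r)}\big|\|w\|^2-\|w'\|^2\big|$. *)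

(* Defs.v *)
From HB Require Import structures.
From mathcomp Require Import all_boot all_order all_algebra.
From mathcomp Require Import all_classical all_reals all_analysis.
Unset Implicit Arguments.
Unset Strict Implicit.
Unset Printing Implicit Defensive.
Import Order.TTheory GRing.Theory Num.Theory.
Import numFieldNormedType.Exports.
Local Open Scope ring_scope.

(* Mode trees.  Modes are 'I_N (mode n+1 of the paper is the ordinal n).   *)
(* Nodes are identified with their labels, so a mode tree is represented   *)
(* by its set of labels T : {set {set 'I_N}}.                              *)

(* A family of labels is a mode tree iff it contains the root [N] and all  *)
(* leaves {n}, no empty label, and is laminar; the tree structure (parent, *)
(* children) is then the Hasse diagram of inclusion, see below.            *)
Definition is_mode_tree {N : nat} (T : {set {set 'I_N}}) : Prop :=
  [/\ [set: 'I_N]%SET \in T,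
      (finset.set0 : {set 'I_N}) \notin T,
      (forall n : 'I_N, [set n] \in T) &
      (forall A B, A \in T -> B \in T ->
         [|| A \subset B, B \subset A | [disjoint A & B]])].

Definition is_leaf {N : nat} (nu : {set 'I_N}) : bool :=
  [exists n, nu == [set n]].

Definition is_interior {N : nat} (T : {set {set 'I_N}}) (nu : {set 'I_N}) : bool :=
  (nu \in T) && ~~ is_leaf nu.

Definition children {N : nat} (T : {set {set 'I_N}}) (nu : {set 'I_N})
  : {set {set 'I_N}} :=
  [set c in T | (c \proper nu) &&
                [forall d in T, ~~ ((c \proper d) && (d \proper nu))]].

Definition parent {N : nat} (T : {set {set 'I_N}}) (nu : {set 'I_N})
  : option {set 'I_N} :=
  [pick p in T | (nu \proper p) && [forall q in T, (nu \proper q) ==> (p \subset q)]].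

Definition nrows {N : nat} (D : 'I_N -> nat) (Rk : {set 'I_N} -> nat)
  (nu : {set 'I_N}) : nat :=
  if [pick n | nu == [set n]] is Some n then D n else Rk nu.

Definition ncols {N : nat} (D : 'I_N -> nat) (T : {set {set 'I_N}})
  (Rk : {set 'I_N} -> nat) (nu : {set 'I_N}) : nat :=
  if parent T nu is Some p then nrows D Rk p else 1%N.

(* Weights W nu a b = entry (a,b) (0-based) of W^(nu); entries outside     *)
(* [nrows nu] x [ncols nu], or at labels outside T, are irrelevant.        *)
Definition weights (R : realType) (N : nat) := {set 'I_N} -> nat -> nat -> R.

Definition tidx {N : nat} (D : 'I_N -> nat) := {dffun forall n : 'I_N, 'I_(D n)}.

Definition tensor (R : realType) {N : nat} (D : 'I_N -> nat) := tidx D -> R.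

Definition tinner {R : realType} {N : nat} {D : 'I_N -> nat}
  (A B : tensor R D) : R := \sum_(i : tidx D) A i * B i.

Definition tnorm {R : realType} {N : nat} {D : 'I_N -> nat} (A : tensor R D) : R :=
  Num.sqrt (tinner A A).

(* Intermediate tensors W^(nu,r), with an optional override (nu0, r0, cf): *)
(* at node nu0 the produced tensor is replaced by                          *)
(*   cf * W^(nu0)_{r0, r} (x)_{c in C(nu0)} W^(c, r0).                     *)
(* A tensor at node nu is represented as a function of the full multi-index *)
(* which only reads the coordinates in nu; the permutation pi_nu of the     *)
(* paper is thus built in (modes indexed by their names, not positions).    *)
Fixpoint tens_ov {R : realType} {N : nat} (D : 'I_N -> nat) (T : {set {set 'I_N}})
  (Rk : {set 'I_N} -> nat) (W : weights R N)
  (ov : option ({set 'I_N} * nat * R)) (fuel : nat)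
  (nu : {set 'I_N}) (r : nat) (i : tidx D) : R :=
  if fuel is k.+1 then
    if [pick n | nu == [set n]] is Some n then W nu (nat_of_ord (i n)) r
    else
      match ov with
      | Some (nu0, r0, cf) =>
          if nu == nu0 then
            cf * W nu r0 r * \prod_(c in children T nu) @tens_ov R N D T Rk W ov k c r0 i
          else
            \sum_(r' < Rk nu)
               W nu r' r * \prod_(c in children T nu) @tens_ov R N D T Rk W ov k c r' i
      | None =>
            \sum_(r' < Rk nu)
               W nu r' r * \prod_(c in children T nu) @tens_ov R N D T Rk W ov k c r' i
      end
  else 0.

(* End tensor W_H (fuel N.+1 exceeds the depth of any mode tree over [N]) *)
Definition end_tensor {R : realType} {N : nat} (D : 'I_N -> nat) (T : {set {set 'I_N}})
  (Rk : {set 'I_N} -> nat) (W : weights R N) : tensor R D :=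
  fun i => tens_ov D T Rk W None N.+1 [set: 'I_N]%SET 0%N i.

Definition row_sqnorm {R : realType} {N : nat} (D : 'I_N -> nat) (T : {set {set 'I_N}})
  (Rk : {set 'I_N} -> nat) (W : weights R N) (nu : {set 'I_N}) (r : nat) : R :=
  \sum_(j < ncols D T Rk nu) W nu r j ^+ 2.

Definition col_sqnorm {R : realType} {N : nat} (D : 'I_N -> nat)
  (Rk : {set 'I_N} -> nat) (W : weights R N) (c : {set 'I_N}) (r : nat) : R :=
  \sum_(a < nrows D Rk c) W c a r ^+ 2.

Definition lc_sqnorms {R : realType} {N : nat} (D : 'I_N -> nat) (T : {set {set 'I_N}})
  (Rk : {set 'I_N} -> nat) (W : weights R N) (nu : {set 'I_N}) (r : nat) : seq R :=
  row_sqnorm D T Rk W nu r :: [seq col_sqnorm D Rk W c r | c <- enum (children T nu)].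

Definition sigma {R : realType} {N : nat} (D : 'I_N -> nat) (T : {set {set 'I_N}})
  (Rk : {set 'I_N} -> nat) (W : weights R N) (nu : {set 'I_N}) (r : nat) : R :=
  Num.sqrt (row_sqnorm D T Rk W nu r) *
  \prod_(c in children T nu) Num.sqrt (col_sqnorm D Rk W c r).

Definition E_tensor {R : realType} {N : nat} (D : 'I_N -> nat) (T : {set {set 'I_N}})
  (Rk : {set 'I_N} -> nat) (W : weights R N) (nu : {set 'I_N}) (r : nat) : tensor R D :=
  let s := sigma D T Rk W nu r in
  fun i => if s == 0 then 0
           else tens_ov D T Rk W (Some (nu, r, s^-1)) N.+1 [set: 'I_N]%SET 0%N i.

Definition unbalancedness {R : realType} {N : nat} (D : 'I_N -> nat)
  (T : {set {set 'I_N}}) (Rk : {set 'I_N} -> nat) (W : weights R N) : R :=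
  \big[Num.max/0]_(nu | is_interior T nu) \big[Num.max/0]_(r < Rk nu)
    \big[Num.max/0]_(x <- lc_sqnorms D T Rk W nu r)
      \big[Num.max/0]_(y <- lc_sqnorms D T Rk W nu r) `|x - y|.

Definition has_gradient {R : realType} {N : nat} {D : 'I_N -> nat}
  (L : tensor R D -> R) (G : tensor R D -> tensor R D) : Prop :=
  forall X : tensor R D, forall eps : R, 0 < eps -> exists2 delta : R, 0 < delta &
    forall H : tensor R D, tnorm H < delta ->
      `|L (fun i => X i + H i) - L X - tinner (G X) H| <= eps * tnorm H.

(* G is Lipschitz on every compact set (equivalently, every closed ball) *)
Definition locally_lipschitz {R : realType} {N : nat} {D : 'I_N -> nat}
  (G : tensor R D -> tensor R D) : Prop :=
  forall B : R, exists K : R, forall X Y : tensor R D,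
    tnorm X <= B -> tnorm Y <= B ->
    tnorm (fun i => G X i - G Y i) <= K * tnorm (fun i => X i - Y i).

Definition deriv_nonneg {R : realType} (f : R -> R) (t d : R) : Prop :=
  forall eps : R, 0 < eps -> exists2 delta : R, 0 < delta &
    forall h : R, h != 0 -> `|h| < delta -> 0 <= t + h ->
      `|(f (t + h) - f t) / h - d| <= eps.

Definition upd {R : realType} {N : nat} (W : weights R N) (nu : {set 'I_N})
  (a b : nat) (s : R) : weights R N :=
  fun mu i j => if [&& mu == nu, i == a & j == b] then W mu i j + s else W mu i j.

Definition phi_H {R : realType} {N : nat} (D : 'I_N -> nat) (T : {set {set 'I_N}})
  (Rk : {set 'I_N} -> nat) (L : tensor R D -> R) (W : weights R N) : R :=
  L (end_tensor D T Rk W).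

Definition gradient_flow {R : realType} {N : nat} (D : 'I_N -> nat)
  (T : {set {set 'I_N}}) (Rk : {set 'I_N} -> nat) (L : tensor R D -> R)
  (Wt : R -> weights R N) : Prop :=
  forall t : R, 0 <= t -> forall nu, nu \in T ->
  forall a b : nat, (a < nrows D Rk nu)%N -> (b < ncols D T Rk nu)%N ->
    exists g : R,
      is_derive (0 : R^o) (1 : R^o)
        (fun s : R^o => phi_H D T Rk L (upd (Wt t) nu a b s) : R^o) g /\
      deriv_nonneg (fun u => Wt u nu a b) t (- g).

(* Main.v *)
Require Import Defs.
From HB Require Import structures.
From mathcomp Require Import all_boot all_order all_algebra.
From mathcomp Require Import all_classical all_reals all_analysis.
From mathcomp Require Import ring lra.
Import Order.TTheory GRing.Theory Num.Theory.
Import numFieldNormedType.Exports.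
Local Open Scope ring_scope.

(** The end tensor is affine in each weight vector w of LC(nu, r), and its
    linear part evaluated at w itself is the unnormalized component tensor
    F = sigma_{nu,r} E_{nu,r}, whichever w is chosen.  Hence under gradient flow
    every |w|^2 has the same derivative 2 <- grad L, F>; being equal at time 0,
    the squared norms share a common value q at all times, and
    sigma = (sqrt q)^L, with L = L_nu, can be differentiated directly.  When q
    vanishes, F = 0, so q' = 0 and sigma = q (sqrt q)^(L-2) has derivative 0 as
    well, because nu has at least one child. *)

(** * Calculus of derivatives relative to the half-line of nonnegative times *)

Section DerivNonneg.
Local Open Scope classical_set_scope.
Context {R : realType}.
Implicit Types (f g : R -> R) (t d e : R).

(** Nonzero increments tending to 0 that keep [t + h] in the half-line: two-sided for positive [t],
    one-sided at [t = 0]. It turns [deriv_nonneg] into a limit, so that limit algebra applies. *)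
Local Notation forward t := (within [set h : R | 0 <= t + h] (0 : R)^').

Lemma deriv_nonnegP f t d :
  deriv_nonneg f t d <-> (f (t + h) - f t) / h @[h --> forward t] --> d.
Proof.
split=> [fd|/cvgrPdist_le fd e e0].
  apply/cvgrPdist_le => e /fd [del del0 fdel]; rewrite near_withinE near_withinE.
  apply/nbhs_ballP; exists del => //= h; rewrite /ball/= sub0r normrN => hdel h0 th.
  by rewrite distrC fdel.
have := fd _ e0; rewrite near_withinE near_withinE => /nbhs_ballP[del /= del0 fdel].
exists del => // h h0 hdel th; rewrite distrC; apply: fdel => //.
by rewrite /ball/= sub0r normrN.
Qed.

Lemma forward_neq0 t : \forall h \near forward t, h != 0.
Proof. by rewrite near_withinE near_withinE; near=> h. Unshelve. all: by end_near. Qed.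

Lemma cvg_forward t : h @[h --> forward t] --> (0 : R).
Proof. by apply: cvg_trans; first exact: cvg_within; exact: cvg_within. Qed.

Lemma deriv_nonneg_continuous f t d :
  deriv_nonneg f t d -> f (t + h) @[h --> forward t] --> f t.
Proof.
move=> /deriv_nonnegP fd.
have : (f (t + h) - f t) / h * h + f t @[h --> forward t] --> d * 0 + f t.
  by apply: cvgD; [apply: cvgM => //; exact: cvg_forward | exact: cvg_cst].
rewrite mulr0 add0r; apply: cvg_trans; apply: near_eq_cvg.
have := forward_neq0 t; apply: filterS => h h0.
by rewrite divfK // subrK.
Qed.

Lemma deriv_nonneg_eq f g t d : 0 <= t -> (forall u, 0 <= u -> f u = g u) ->
  deriv_nonneg f t d -> deriv_nonneg g t d.
Proof.
move=> t0 fg fd e /fd [del del0 fdel]; exists del => // h h0 hdel th.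
by rewrite -!fg //; exact: fdel.
Qed.

Lemma deriv_nonneg_cst (c t : R) : deriv_nonneg (fun=> c) t 0.
Proof.
by move=> e e0; exists 1 => // h _ _ _; rewrite subrr mul0r subrr normr0 ltW.
Qed.

Lemma deriv_nonnegD f g t d e : deriv_nonneg f t d -> deriv_nonneg g t e ->
  deriv_nonneg (fun u => f u + g u) t (d + e).
Proof.
move=> /deriv_nonnegP fd /deriv_nonnegP ge; apply/deriv_nonnegP.
apply: cvg_trans (cvgD fd ge); apply: near_eq_cvg; near=> h => /=.
rewrite -mulrDl !fctE; congr (_ / _); ring.
Unshelve. all: by end_near. Qed.

Lemma deriv_nonnegB f g t d e : deriv_nonneg f t d -> deriv_nonneg g t e ->
  deriv_nonneg (fun u => f u - g u) t (d - e).
Proof.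
move=> /deriv_nonnegP fd /deriv_nonnegP ge; apply/deriv_nonnegP.
apply: cvg_trans (cvgB fd ge); apply: near_eq_cvg; near=> h => /=.
rewrite -mulrBl !fctE; congr (_ / _); ring.
Unshelve. all: by end_near. Qed.

Lemma deriv_nonneg_sum n (f : 'I_n -> R -> R) t (d : 'I_n -> R) :
  (forall j, deriv_nonneg (f j) t (d j)) ->
  deriv_nonneg (fun u => \sum_j f j u) t (\sum_j d j).
Proof.
elim: n f d => [|n IHn] f d fd.
  by rewrite big_ord0; under eq_fun do rewrite big_ord0; exact: deriv_nonneg_cst.
rewrite big_ord_recl; under eq_fun do rewrite big_ord_recl.
apply: (deriv_nonnegD (f ord0) (fun u => \sum_j f (lift ord0 j) u)); first exact: fd.
by apply: IHn => j; exact: fd.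
Qed.

Lemma deriv_nonnegM f g t d e : deriv_nonneg f t d -> deriv_nonneg g t e ->
  deriv_nonneg (fun u => f u * g u) t (d * g t + f t * e).
Proof.
move=> fd ge; have gc := deriv_nonneg_continuous _ _ _ ge.
move: fd ge => /deriv_nonnegP fd /deriv_nonnegP ge; apply/deriv_nonnegP.
apply: cvg_trans (cvgD (cvgM fd gc) (cvgM (cvg_cst (f t)) ge)).
apply: near_eq_cvg; near=> h; rewrite !fctE /=; ring.
Unshelve. all: by end_near. Qed.

Lemma deriv_nonnegX f t d n : deriv_nonneg f t d ->
  deriv_nonneg (fun u => f u ^+ n) t (n%:R * f t ^+ n.-1 * d).
Proof.
move=> fd; elim: n => [|n IHn].
  by rewrite mul0r mul0r; apply: deriv_nonneg_cst.
have -> : n.+1%:R * f t ^+ n.+1.-1 * d = d * f t ^+ n + f t * (n%:R * f t ^+ n.-1 * d).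
  (* The product [f t * f t ^+ n.-1] is [f t ^+ n] only for positive [n]; at [n = 0] the factor
     [n%:R] removes it. *)
  case: n {IHn} => [|n] /=; rewrite ?expr0 ?exprS -?natr1; ring.
by under eq_fun do rewrite exprS; exact: (deriv_nonnegM f (fun u => f u ^+ n)).
Qed.

(** Multiplying by the conjugate, the quotient of [Num.sqrt \o f] is that of [f] divided by
    [Num.sqrt (f (t + h)) + Num.sqrt (f t)], whose limit is nonzero. *)
Lemma deriv_nonneg_sqrt f t d : 0 < f t -> (forall u, 0 <= u -> 0 <= f u) ->
  deriv_nonneg f t d ->
  deriv_nonneg (fun u => Num.sqrt (f u)) t (d / (2 * Num.sqrt (f t))).
Proof.
move=> ft0 f0 fd; have fc := deriv_nonneg_continuous _ _ _ fd.
have sc : Num.sqrt (f (t + h)) @[h --> forward t] --> Num.sqrt (f t).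
  by apply: continuous_cvg fc; apply: sqrt_continuous.
have st0 : 0 < Num.sqrt (f t) by rewrite sqrtr_gt0.
move: fd => /deriv_nonnegP fd; apply/deriv_nonnegP.
have -> : 2 * Num.sqrt (f t) = Num.sqrt (f t) + Num.sqrt (f t) by ring.
have ss0 := lt0r_neq0 (addr_gt0 st0 st0).
apply: cvg_trans (cvgM fd (cvgV ss0 (cvgD sc (cvg_cst (Num.sqrt (f t)))))).
apply: near_eq_cvg.
rewrite near_withinE near_withinE; near=> h => h0 /= th.
rewrite !fctE -[X in (X - _) / h](sqr_sqrtr (f0 _ th)).
rewrite -[X in (_ - X) / h](sqr_sqrtr (ltW ft0)).
have : Num.sqrt (f (t + h)) + Num.sqrt (f t) != 0 by rewrite gt_eqF ?ltr_wpDl ?sqrtr_ge0.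
by move: (Num.sqrt (f (t + h))) (Num.sqrt (f t)) => a b ab0; field; rewrite h0 ab0.
Unshelve. all: by end_near. Qed.

(** The square root is not differentiable at 0, but with exponent at least 2 a whole factor [f]
    splits off: its quotient tends to 0 while the remaining power of the root converges. *)
Lemma deriv_nonneg_sqrtX0 f t n : 0 <= t -> f t = 0 -> (forall u, 0 <= u -> 0 <= f u) ->
  deriv_nonneg f t 0 -> deriv_nonneg (fun u => Num.sqrt (f u) ^+ n.+2) t 0.
Proof.
move=> t0 ft0 f0 fd; have fc := deriv_nonneg_continuous _ _ _ fd.
apply: (deriv_nonneg_eq (fun u => f u * Num.sqrt (f u) ^+ n)) => // [u u0|].
  by rewrite -[X in X * _](sqr_sqrtr (f0 u u0)) -exprD add2n.
have sc : Num.sqrt (f (t + h)) ^+ n @[h --> forward t] --> Num.sqrt (f t) ^+ n.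
  apply: continuous_cvg (@exprn_continuous _ n _) _.
  by apply: continuous_cvg fc; exact: sqrt_continuous.
move: fd => /deriv_nonnegP fd; rewrite -(mul0r (Num.sqrt (f t) ^+ n)).
apply/deriv_nonnegP; apply: cvg_trans (cvgM fd sc).
by apply: near_eq_cvg; near=> h; rewrite /= ft0; ring.
Unshelve. all: by end_near. Qed.

(** Passes from first-order expansions with small remainder, the form used in [has_gradient], to the
    derivatives of the library. *)
Lemma is_derive_linear_approx (f : R -> R) (x d : R) :
  (forall e : R, 0 < e -> exists2 del : R, 0 < del & forall h : R, `|h| < del ->
    `|f (x + h) - f x - d * h| <= e * `|h|) ->
  is_derive (x : R^o) (1 : R^o) (f : R^o -> R^o) (d : R^o).
Proof.
move=> fd.
have fc : (fun h : R => h^-1 *: ((f \o shift x) (h *: (1 : R^o)) - f x) : R^o)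
    @ (0 : R)^' --> (d : R^o).
  apply/cvgrPdist_le => e /fd [del del0 fdel]; rewrite near_withinE.
  apply/nbhs_ballP; exists del => //= h; rewrite /ball/= sub0r normrN => hdel h0.
  have -> : d - h^-1 *: (f (h *: (1 : R^o) + x) - f x) =
            - h^-1 * (f (x + h) - f x - d * h) :> R.
    by rewrite /GRing.scale /= mulr1 (addrC h); field.
  rewrite normrM normrN normfV mulrC ler_pdivrMr ?normr_gt0 //.
  exact: fdel.
by split; [apply/cvg_ex; exists (d : R^o) | exact/cvg_lim].
Qed.

(** Freezing [f] at the value [f 0] for negative arguments gives a function on the whole line with
    zero derivative everywhere, to which the usual constancy theorem applies. *)
Lemma deriv_nonneg0_cst f : (forall t, 0 <= t -> deriv_nonneg f t 0) ->
  forall t, 0 <= t -> f t = f 0.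
Proof.
move=> fd t t0; pose F (x : R^o) : R^o := f (Num.max x 0).
suff Fd (x : R^o) : is_derive x (1 : R^o) F 0.
  have := @is_derive_0_is_cst R F t 0 Fd; rewrite /F maxxx.
  by rewrite (max_idPl t0).
apply: (is_derive_linear_approx (fun x => f (Num.max x 0))) => e e0.
have m0 : 0 <= Num.max x 0 by rewrite le_max lexx orbT.
have [del del0 fdel] := fd _ m0 _ e0; exists del => // h hdel.
rewrite mul0r subr0; set y := Num.max x 0; set z := Num.max (x + h) 0.
(* Clamping at 0 is 1-Lipschitz, so the estimate for [f] at the clamped points transfers to [F]. *)
have zy : `|z - y| <= `|h|.
  have := ler_norm h; have := ler_norm (- h); rewrite normrN /z /y => ? ?.
  case: (lerP x 0); case: (lerP (x + h) 0) => ? ?;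
    rewrite ler_norml; apply/andP; split; lra.
have [->|zy0] := eqVneq z y; first by rewrite subrr normr0 mulr_ge0 // ltW.
have hne : z - y != 0 by rewrite subr_eq0.
have := fdel _ hne (le_lt_trans zy hdel); rewrite subrKC subr0.
rewrite normrM normfV ler_pdivrMr ?normr_gt0 // => /(_ _)/le_trans; apply.
  by rewrite le_max lexx orbT.
by rewrite ler_wpM2l // ltW.
Qed.
End DerivNonneg.

(** * Combinatorics of mode trees as laminar families *)

Section ModeTree.
Context {N : nat} {T : {set {set 'I_N}}}.
Hypothesis treeT : is_mode_tree T.
Implicit Types (mu nu c d A : {set 'I_N}).

Lemma node_neq0 mu : mu \in T -> mu != finset.set0.
Proof. by case: treeT => _ T0 _ _ muT; apply: contraNneq T0 => <-. Qed.

Lemma node_card_gt0 mu : mu \in T -> (0 < #|mu|)%N.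
Proof. by move=> /node_neq0; rewrite card_gt0. Qed.

Lemma childP {mu c} : c \in children T mu ->
  [/\ c \in T, c \proper mu & forall d, d \in T -> c \proper d -> d \proper mu -> False].
Proof.
rewrite inE => /and3P[cT cmu /forallP cmax]; split=> // d dT cd dmu.
by have := cmax d; rewrite dT cd dmu.
Qed.

Lemma children_disjoint mu c d : c \in children T mu -> d \in children T mu ->
  c != d -> [disjoint c & d].
Proof.
move=> /childP[cT cmu cmax] /childP[dT dmu dmax] cd.
case: treeT => _ _ _ /(_ _ _ cT dT) /or3P[cd'|dc'|//].
  by case: (cmax d dT _ dmu); rewrite finset.properEneq cd.
by case: (dmax c cT _ cmu); rewrite finset.properEneq eq_sym cd.
Qed.

(** Among the nodes that contain [nu] and lie strictly inside [mu], an inclusion-maximal one has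
    nothing between itself and [mu]. *)
Lemma child_above mu nu : mu \in T -> nu \in T -> nu \proper mu ->
  exists2 c, c \in children T mu & nu \subset c.
Proof.
move=> muT nuT numu.
have [|c /maxsetP[/and3P[cT cmu nuc] cmax] _] :=
  @maxset_exists _ [pred c | [&& c \in T, c \proper mu & nu \subset c]] nu.
  by rewrite /= nuT numu subxx.
exists c => //; rewrite inE cT cmu; apply/forallP => d; apply/implyP => dT.
apply/negP => /andP[cd dmu].
have := cmax d; rewrite /= dT dmu (fintype.subset_trans nuc (proper_sub cd)) => /(_ isT).
by move=> /(_ (proper_sub cd)) dc; rewrite dc fintype.properxx in cd.
Qed.

(** By laminarity a node strictly above [c] contains [mu], lies strictly inside [mu], or is disjoint
    from it. The second contradicts that [c] is a child, the third that [c] is nonempty. *)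
Lemma parent_child mu c : mu \in T -> c \in children T mu -> parent T c = Some mu.
Proof.
move=> muT /childP[cT cmu cmax].
have above q : q \in T -> c \proper q -> mu \subset q.
  move=> qT cq; case: treeT => _ _ _ /(_ _ _ muT qT) /or3P[//|qmu|dis].
    apply/negPn/negP => muq; apply: (cmax q qT cq).
    by rewrite fintype.properE qmu.
  have /finset.set0Pn[x xc] := node_neq0 _ cT.
  have := disjointFr dis (fintype.subsetP (proper_sub cmu) _ xc).
  by rewrite (fintype.subsetP (proper_sub cq) _ xc).
rewrite /parent; case: pickP => [p /and3P[pT cp /forallP pmin]|/(_ mu)].
  congr Some; apply/eqP; rewrite finset.eqEsubset above // andbT.
  by have := pmin mu; rewrite muT cmu.
rewrite muT cmu => /negbT /negP[]; apply/forallP => q; apply/implyP => qT.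
by apply/implyP; exact: above.
Qed.

Lemma parent_root : parent T [set: 'I_N] = None.
Proof.
rewrite /parent; case: pickP => // p /and3P[_ + _].
by rewrite fintype.properE finset.subsetT andbF.
Qed.

(** The leaf of any element of [mu] lies strictly below [mu], hence below some child. Local
    components therefore have at least two vectors, which matters where [sigma] vanishes. *)
Lemma interior_children mu : is_interior T mu -> (0 < #|children T mu|)%N.
Proof.
case/andP=> muT nleaf; have /finset.set0Pn[n nmu] := node_neq0 _ muT.
case: treeT => _ _ /(_ n) nT _.
have [|c cmu _] := @child_above mu [set n]%SET muT nT.
  rewrite finset.properEneq finset.sub1set nmu andbT eq_sym.
  by apply: contra nleaf => /eqP muE; apply/existsP; exists n; rewrite {1}muE.
by rewrite card_gt0; apply/finset.set0Pn; exists c.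
Qed.

Lemma pick_interior mu : is_interior T mu -> [pick n | mu == [set n]%SET] = None.
Proof.
case/andP=> _ nleaf; case: pickP => // n mun.
by case/negP: nleaf; apply/existsP; exists n.
Qed.

Lemma nodeP mu : mu \in T -> (exists n, mu = [set n]%SET) \/ is_interior T mu.
Proof.
move=> muT; rewrite /is_interior muT; have [/existsP[n /eqP]|] := boolP (is_leaf mu).
  by left; exists n.
by right.
Qed.

Lemma pick_leaf (n : 'I_N) : [pick m | [set n]%SET == [set m]%SET] = Some n.
Proof.
by case: pickP => [m /eqP/finset.set1_inj->//|/(_ n)]; rewrite eqxx.
Qed.

Lemma parent_interior mu nu : mu \in T -> nu \in T -> nu \proper mu -> is_interior T mu.
Proof.
move=> muT nuT numu; case: (nodeP mu muT) => // -[n muE].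
have := proper_card numu; rewrite muE finset.cards1 ltnS leqn0 => /eqP nu0.
by have := node_card_gt0 _ nuT; rewrite nu0.
Qed.

(** * Locality and multilinearity of the intermediate tensors *)

Section Tensors.
Context {R : realType} {D : 'I_N -> nat} {Rk : {set 'I_N} -> nat}.
Implicit Types (W : weights R N) (i : tidx D) (ov : option ({set 'I_N} * nat * R)).

Lemma nrows_interior mu : is_interior T mu -> nrows D Rk mu = Rk mu.
Proof. by rewrite /nrows => /pick_interior->. Qed.

Lemma nrows_leaf n : nrows D Rk [set n] = D n.
Proof. by rewrite /nrows pick_leaf. Qed.

Lemma ncols_child mu c : is_interior T mu -> c \in children T mu ->
  ncols D T Rk c = Rk mu.
Proof.
move=> muI cmu; case/andP: (muI) => muT _.
by rewrite /ncols (parent_child mu c muT cmu) nrows_interior.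
Qed.

Lemma ncols_root : ncols D T Rk [set: 'I_N] = 1%N.
Proof. by rewrite /ncols parent_root. Qed.

(** Isolates what an override does at a single node, so that two overrides can be compared node by
    node on a subtree. *)
Definition override_at ov mu : option (nat * R) :=
  if ov is Some (nu, r, x) then if mu == nu then Some (r, x) else None else None.

Lemma tens_leaf W ov k n r i :
  tens_ov D T Rk W ov k.+1 [set n] r i = W [set n]%SET (i n) r.
Proof. by rewrite /= pick_leaf. Qed.

Lemma tens_interior W ov k mu r i : is_interior T mu ->
  tens_ov D T Rk W ov k.+1 mu r i =
  if override_at ov mu is Some (a, x) then
    x * W mu a r * \prod_(c in children T mu) tens_ov D T Rk W ov k c a i
  else \sum_(a < Rk mu)
    W mu a r * \prod_(c in children T mu) tens_ov D T Rk W ov k c a i.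
Proof.
move=> muI /=; rewrite (pick_interior mu muI).
by case: ov => [[[nu a] x]|//] /=; case: eqP.
Qed.

Local Arguments tens_ov : simpl never.

(** Evaluation at [mu] visits only the subtree below it, and labels shrink strictly from parent to
    child, so fuel [#|mu|] already suffices. This licenses every later change of fuel, weights or
    override. *)
Lemma tens_local W W' ov ov' k k' mu r i : mu \in T ->
  (#|mu| <= k)%N -> (#|mu| <= k')%N ->
  (forall A, A \in T -> A \subset mu ->
     W A =2 W' A /\ override_at ov A = override_at ov' A) ->
  tens_ov D T Rk W ov k mu r i = tens_ov D T Rk W' ov' k' mu r i.
Proof.
elim: k k' mu r => [|k IHk] [|k'] mu r muT muk muk' WW';
  try by have := node_card_gt0 _ muT; rewrite ltnNge ?muk ?muk'.
have [WW'mu ov_mu] := WW' mu muT (subxx _).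
case: (nodeP mu muT) => [[n muE]|muI]; first by rewrite muE !tens_leaf -muE.
have prodE a : \prod_(c in children T mu) tens_ov D T Rk W ov k c a i =
               \prod_(c in children T mu) tens_ov D T Rk W' ov' k' c a i.
  apply: eq_bigr => c /childP[cT cmu _]; have cltmu := proper_card cmu.
  apply: IHk => //; try by rewrite -ltnS (leq_trans cltmu).
  by move=> A AT Ac; apply: WW' => //; exact: fintype.subset_trans Ac (proper_sub cmu).
rewrite !tens_interior // ov_mu; case: override_at => [[a x]|].
  by rewrite WW'mu prodE.
by apply: eq_bigr => a _; rewrite WW'mu prodE.
Qed.

(** The matrix at [mu] is read only at the top of the recursion. The coefficient [B a] is an
    indicator at a leaf and the product of the child tensors at an interior node. *)
Lemma tens_linear W k mu i : mu \in T -> (#|mu| <= k)%N ->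
  exists B : nat -> R, forall W',
    (forall A, A \in T -> A \proper mu -> W' A =2 W A) ->
    forall r, tens_ov D T Rk W' None k mu r i = \sum_(a < nrows D Rk mu) W' mu a r * B a.
Proof.
case: k => [|k] muT muk; first by have := node_card_gt0 _ muT; rewrite ltnNge muk.
case: (nodeP mu muT) => [[n muE]|muI].
  exists (fun a : nat => (a == i n :> nat)%:R) => W' _ r; rewrite muE tens_leaf nrows_leaf.
  rewrite (bigD1 (i n)) //= eqxx mulr1 big1 ?addr0 // => a /negPf ain.
  by rewrite -val_eqE in ain; rewrite ain mulr0.
exists (fun a => \prod_(c in children T mu) tens_ov D T Rk W None k c a i) => W' WW' r.
rewrite tens_interior // nrows_interior //; apply: eq_bigr => a _; congr (_ * _).
apply: eq_bigr => c /childP[cT cmu _]; have cltmu := proper_card cmu.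
apply: tens_local => //; try by rewrite -ltnS (leq_trans cltmu).
by move=> A AT Ac; split=> //; apply: WW' => //; exact: sub_proper_trans Ac cmu.
Qed.

(** Only one child of [mu] contains [nu]; the tensors of its siblings do not see the subtree of
    [nu]. Going down the path from [mu] to [nu], these sibling products and the path weights
    accumulate into [K]. The fuel [#|nu|.+1] leaves [#|nu|] for the children after one unfolding. *)
Lemma tens_context W nu k mu i : nu \in T -> mu \in T -> nu \subset mu ->
  (#|mu| <= k)%N ->
  exists K : nat -> nat -> R, forall W' ov,
    (forall A, A \in T -> ~~ (A \subset nu) -> W' A =2 W A /\ override_at ov A = None) ->
    forall r, (r < ncols D T Rk mu)%N ->
    tens_ov D T Rk W' ov k mu r i =
    \sum_(b < ncols D T Rk nu) K r b * tens_ov D T Rk W' ov #|nu|.+1 nu b i.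
Proof.
elim: k mu => [|k IHk] mu nuT muT numu muk.
  by have := node_card_gt0 _ muT; rewrite ltnNge muk.
have [<-|nu_neq] := eqVneq nu mu.
  (* On a path of length zero the coefficient matrix is the identity. *)
  exists (fun r b => (r == b)%:R) => W' ov _ r rlt.
  rewrite [RHS](bigD1 (Ordinal rlt)) // eqxx mul1r [X in _ = _ + X]big1 ?addr0; first last.
    move=> b bne; have /negPf-> : r != b by apply: contraNneq bne => rb; apply/eqP/val_inj.
    by rewrite mul0r.
  by apply: tens_local => //; rewrite ?(leq_trans _ muk) ?subset_leq_card.
have {nu_neq}numu : nu \proper mu by rewrite finset.properEneq nu_neq.
have muI := parent_interior mu nu muT nuT numu.
have [d dmu nud] := child_above mu nu muT nuT numu.
have childk c : c \in children T mu -> (#|c| <= k)%N.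
  by case/childP => _ /proper_card cltmu _; rewrite -ltnS (leq_trans cltmu).
have [dT dpmu _] := childP dmu.
have [K KE] := IHk d nuT dT nud (childk d dmu).
exists (fun r b => \sum_(a < Rk mu) W mu a r *
  (\prod_(c in children T mu | c != d) tens_ov D T Rk W None k c a i) * K a b).
move=> W' ov WW' r rlt.
have [WW'mu ovmu] : W' mu =2 W mu /\ override_at ov mu = None.
  by apply: WW' => //; move: numu; rewrite fintype.properE => /andP[].
rewrite tens_interior // ovmu.
under eq_bigr => a _.
  rewrite (bigD1 d) //= KE ?(ncols_child mu d muI dmu) //.
  have -> : \prod_(c in children T mu | c != d) tens_ov D T Rk W' ov k c a i =
            \prod_(c in children T mu | c != d) tens_ov D T Rk W None k c a i.
    apply: eq_bigr => c /andP[cmu cd]; have [cT _ _] := childP cmu.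
    apply: tens_local; rewrite ?childk // => A AT Ac.
    rewrite [override_at None A]/=; apply: WW' => //; apply/negP => Anu.
    (* Since [nu] lies inside [d], which is disjoint from [c], no node below [c] lies below [nu]. *)
    have /finset.set0Pn[x xA] := node_neq0 _ AT.
    have := disjointFr (children_disjoint mu c d cmu dmu cd) (fintype.subsetP Ac _ xA).
    by rewrite (fintype.subsetP (fintype.subset_trans Anu nud) _ xA).
  rewrite WW'mu mulr_suml mulr_sumr; over.
under [RHS]eq_bigr => b _ do rewrite mulr_suml.
rewrite [RHS]exchange_big; apply: eq_bigr => a _; apply: eq_bigr => b _; ring.
Qed.

(* [K i b] is the coefficient of the intermediate tensor at [(nu, b)] in the end
   tensor; it only depends on the weights outside the subtree rooted at [nu]. *)
Definition is_context W nu (K : tidx D -> nat -> R) : Prop := forall W' ov,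
  (forall A, A \in T -> ~~ (A \subset nu) -> W' A =2 W A /\ override_at ov A = None) ->
  forall i, tens_ov D T Rk W' ov N.+1 [set: 'I_N]%SET 0 i =
    \sum_(b < ncols D T Rk nu) K i b * tens_ov D T Rk W' ov #|nu|.+1 nu b i.

Lemma end_context W nu : nu \in T -> exists K, is_context W nu K.
Proof.
move=> nuT; case: (treeT) => rootT _ _ _.
have cardN : (#|[set: 'I_N]%SET| <= N.+1)%N by rewrite finset.cardsT card_ord.
have [K KE] := choice (fun i =>
  tens_context W nu N.+1 _ i nuT rootT (finset.subsetT _) cardN).
exists (fun i => K i 0%N) => W' ov WW' i.
by rewrite (KE i W' ov WW') ?ncols_root.
Qed.

Lemma prod_children_local W ov k nu a i :
  (forall A, A \in T -> A \proper nu -> override_at ov A = None) ->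
  forall W', (forall A, A \in T -> A \proper nu -> W' A =2 W A) ->
  (#|nu| <= k.+1)%N ->
  \prod_(c in children T nu) tens_ov D T Rk W' ov k c a i =
  \prod_(c in children T nu) tens_ov D T Rk W None k c a i.
Proof.
move=> ovnu W' WW' nuk; apply: eq_bigr => c /childP[cT cnu _].
have ck : (#|c| <= k)%N by rewrite -ltnS (leq_trans (proper_card cnu)).
apply: tens_local => // A AT Ac; have Anu := sub_proper_trans Ac cnu.
by rewrite (ovnu A AT Anu); split => //; exact: WW'.
Qed.

Lemma override_at_neq nu r x A : A != nu -> override_at (Some (nu, r, x)) A = None.
Proof. by rewrite /override_at => /negPf->. Qed.

(** The override leaves the context of [nu] untouched and keeps only the [r]-th summand at [nu].
    Both families of directions below are read off from this expansion. *)
Lemma component_context W nu r x : is_interior T nu -> forall K, is_context W nu K ->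
  forall i, tens_ov D T Rk W (Some (nu, r, x)) N.+1 [set: 'I_N]%SET 0 i =
    x * \sum_(b < ncols D T Rk nu) K i b * W nu r b *
        \prod_(c in children T nu) tens_ov D T Rk W None #|nu| c r i.
Proof.
move=> nuI K KE i; rewrite KE; last first.
  move=> A AT Anu; split=> //; apply: override_at_neq.
  by apply: contraNneq Anu => ->.
rewrite mulr_sumr; apply: eq_bigr => b _.
rewrite tens_interior // {1}/override_at eqxx (prod_children_local W) //; first by ring.
by move=> A _ Anu; apply: override_at_neq; move: Anu; rewrite finset.properEneq => /andP[].
Qed.

Lemma override_scale W nu r x i : is_interior T nu ->
  tens_ov D T Rk W (Some (nu, r, x)) N.+1 [set: 'I_N]%SET 0 i =
  x * tens_ov D T Rk W (Some (nu, r, 1)) N.+1 [set: 'I_N]%SET 0 i.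
Proof.
move=> nuI; case/andP: (nuI) => nuT _.
have [K KE] := end_context W nu nuT.
by rewrite !(component_context _ _ _ _ nuI K KE) mul1r.
Qed.

Lemma upd_neq W nu a b s A : A != nu -> upd W nu a b s A =2 W A.
Proof. by move=> /negPf Anu p q; rewrite /upd Anu. Qed.

(** Kronecker factors in place of a conditional let [sum_delta] collapse the sums in which a
    perturbed entry occurs. *)
Lemma upd_eq W nu a b s p q :
  upd W nu a b s nu p q = W nu p q + (p == a)%:R * ((q == b)%:R * s).
Proof.
by rewrite /upd eqxx /=; case: (p == a); case: (q == b); rewrite /= ?mul1r ?mul0r ?addr0.
Qed.

Lemma sum_delta n (j : nat) (f : nat -> R) : (j < n)%N ->
  \sum_(p < n) (p == j :> nat)%:R * f p = f j.
Proof.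
move=> jn; rewrite (bigD1 (Ordinal jn)) //= eqxx mul1r big1 ?addr0 // => p pj.
have /negPf-> : p != j :> nat by apply: contraNneq pj => pj; apply/eqP/val_inj.
by rewrite mul0r.
Qed.

(** Here [P b] is the partial derivative in the entry [W nu r b]: the context coefficient times the
    product of the child tensors at [r]. Weighting by the entries themselves rebuilds the
    unnormalized component. *)
Lemma row_directions W nu r : is_interior T nu -> (r < Rk nu)%N ->
  exists P : nat -> tensor R D,
    (forall b s, (b < ncols D T Rk nu)%N ->
       end_tensor D T Rk (upd W nu r b s) = fun i => end_tensor D T Rk W i + s * P b i) /\
    (forall i, tens_ov D T Rk W (Some (nu, r, 1)) N.+1 [set: 'I_N]%SET 0 i =
       \sum_(b < ncols D T Rk nu) W nu r b * P b i).
Proof.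
move=> nuI rR; case/andP: (nuI) => nuT _; have [K KE] := end_context W nu nuT.
exists (fun b i => K i b * \prod_(c in children T nu) tens_ov D T Rk W None #|nu| c r i).
split=> [b s bn|i]; last first.
  rewrite (component_context _ _ _ _ nuI K KE) mul1r.
  by apply: eq_bigr => b' _; ring.
apply/funext => i; rewrite /end_tensor KE; last first.
  by move=> A _ Anu; split=> //; apply: upd_neq; apply: contraNneq Anu => ->.
rewrite (KE W None) //.
under [LHS]eq_bigr => b' _.
  rewrite tens_interior //=.
  under eq_bigr => a _.
    rewrite upd_eq (prod_children_local W) //; last first.
      by move=> A _ Anu; apply: upd_neq; move: Anu; rewrite finset.properEneq => /andP[].
    rewrite mulrDl -[X in _ + X]mulrA; over.
  rewrite big_split /= (sum_delta _ r (fun a => (b' == b :> nat)%:R * s *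
    \prod_(c in children T nu) tens_ov D T Rk W None #|nu| c a i)) // mulrDr.
  rewrite [X in _ + X](_ : _ = (b' == b :> nat)%:R * (s * (K i b' *
    \prod_(c in children T nu) tens_ov D T Rk W None #|nu| c r i))); last by ring.
  over.
rewrite big_split /= (sum_delta _ b (fun b' => s * (K i b' *
    \prod_(c in children T nu) tens_ov D T Rk W None #|nu| c r i))) //.
by congr (_ + _); apply: eq_bigr => b' _; rewrite tens_interior.
Qed.

(** Column [r] of [c] meets only row [r] of [nu], and the tensor of [c] is linear in it, so the same
    component reappears with the factor of [c] expanded in its entries. *)
Lemma col_directions W nu c r : is_interior T nu -> (r < Rk nu)%N ->
  c \in children T nu ->
  exists P : nat -> tensor R D,
    (forall a s, (a < nrows D Rk c)%N ->
       end_tensor D T Rk (upd W c a r s) = fun i => end_tensor D T Rk W i + s * P a i) /\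
    (forall i, tens_ov D T Rk W (Some (nu, r, 1)) N.+1 [set: 'I_N]%SET 0 i =
       \sum_(a < nrows D Rk c) W c a r * P a i).
Proof.
move=> nuI rR cnu; case/andP: (nuI) => nuT _; have [K KE] := end_context W nu nuT.
have [cT cpnu _] := childP cnu.
have childk d : d \in children T nu -> (#|d| <= #|nu|)%N.
  by case/childP => _ /proper_card/ltnW.
have [B BE] := choice (fun i => tens_linear W #|nu| c i cT (childk c cnu)).
exists (fun a i => (\sum_(b < ncols D T Rk nu) K i b * W nu r b) * (B i a *
  \prod_(d in children T nu | d != c) tens_ov D T Rk W None #|nu| d r i)).
split=> [a s an|i]; last first.
  rewrite (component_context _ _ _ _ nuI K KE) mul1r -mulr_suml.
  rewrite (bigD1 c) //= (BE i W) // [X in _ * X]mulr_suml mulr_sumr.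
  by apply: eq_bigr => a _; ring.
have cneq : c != nu by move: cpnu; rewrite finset.properEneq => /andP[].
apply/funext => i; rewrite /end_tensor KE; last first.
  move=> A _ Anu; split=> //; apply: upd_neq; apply: contraNneq Anu => ->.
  exact: proper_sub.
rewrite (KE W None) //.
(* A perturbation of column [r] of [c] is felt only by the summand [p = r], and there only by the
   factor of [c]. *)
have prodE p : \prod_(d in children T nu) tens_ov D T Rk (upd W c a r s) None #|nu| d p i
  = \prod_(d in children T nu) tens_ov D T Rk W None #|nu| d p i +
    (p == r)%:R * (s * (B i a *
     \prod_(d in children T nu | d != c) tens_ov D T Rk W None #|nu| d p i)).
  rewrite !(bigD1 (P := [in children T nu]) c cnu) /=.
  have -> : \prod_(d in children T nu | d != c)
      tens_ov D T Rk (upd W c a r s) None #|nu| d p i =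
    \prod_(d in children T nu | d != c) tens_ov D T Rk W None #|nu| d p i.
    apply: eq_bigr => d /andP[dnu dc]; have [dT _ _] := childP dnu.
    apply: tens_local; rewrite ?childk // => A AT Ad; split=> //; apply: upd_neq.
    apply: contraTneq Ad => ->; apply/negP => cd.
    have /finset.set0Pn[x xc] := node_neq0 _ cT.
    have := disjointFr (children_disjoint nu d c dnu cnu dc) (fintype.subsetP cd _ xc).
    by rewrite xc.
  rewrite (BE i W) // (BE i (upd W c a r s)); last first.
    by move=> A _ Ac; apply: upd_neq; move: Ac; rewrite finset.properEneq => /andP[].
  under [X in X * _ = _]eq_bigr => q _ do rewrite upd_eq mulrDl -[X in _ + X]mulrA.
  rewrite big_split /= (sum_delta _ a (fun q => (p == r)%:R * s * B i q)) //.
  by ring.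
under [LHS]eq_bigr => b _.
  rewrite tens_interior //=.
  under eq_bigr => p _.
    rewrite prodE upd_neq; last by rewrite eq_sym.
    rewrite mulrDr.
    rewrite [X in _ + X]mulrCA; over.
  rewrite big_split /= (sum_delta _ r (fun p => W nu p b * (s * (B i a *
    \prod_(d in children T nu | d != c) tens_ov D T Rk W None #|nu| d p i)))) // mulrDr.
  over.
rewrite big_split /=; congr (_ + _).
  by apply: eq_bigr => b _; rewrite tens_interior.
by rewrite mulr_suml [RHS]mulr_sumr; apply: eq_bigr => b _; ring.
Qed.
End Tensors.
End ModeTree.

(** * Chain rule and evolution of squared norms *)

Section Gradient.
Context {R : realType} {N : nat} {D : 'I_N -> nat}.
Implicit Types (A B P X : tensor R D).

Lemma tnormZ (s : R) P : tnorm (fun i => s * P i) = `|s| * tnorm P.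
Proof.
rewrite /tnorm /tinner -sqrtr_sqr -sqrtrM ?sqr_ge0 // mulr_sumr.
by congr Num.sqrt; apply: eq_bigr => i _; ring.
Qed.

Lemma tinnerZr A (s : R) P : tinner A (fun i => s * P i) = s * tinner A P.
Proof. by rewrite /tinner mulr_sumr; apply: eq_bigr => i _; ring. Qed.

Lemma tinnerNl A P : tinner (fun i => - A i) P = - tinner A P.
Proof. by rewrite /tinner -sumrN; apply: eq_bigr => i _; rewrite mulNr. Qed.

Lemma tinner_sumr A n (P : 'I_n -> tensor R D) :
  tinner A (fun i => \sum_j P j i) = \sum_j tinner A (P j).
Proof. by rewrite /tinner exchange_big; apply: eq_bigr => i _; rewrite mulr_sumr. Qed.

Lemma is_derive_gradient (L : tensor R D -> R) G X P : has_gradient L G ->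
  is_derive (0 : R^o) (1 : R^o)
    ((fun s => L (fun i => X i + s * P i)) : R^o -> R^o) (tinner (G X) P : R^o).
Proof.
move=> LG; apply: is_derive_linear_approx => e e0.
(* Scaling by [tnorm P + 1] instead of [tnorm P] covers the direction [P = 0]. *)
have P1 : 0 < tnorm P + 1 by rewrite ltr_pwDr ?sqrtr_ge0.
have [del del0 LGdel] := LG X _ (divr_gt0 e0 P1).
exists (del / (tnorm P + 1)) => [|h hdel]; first exact: divr_gt0.
have hP : `|h| * tnorm P <= `|h| * (tnorm P + 1) by rewrite ler_wpM2l // lerDl.
have -> : (fun i => X i + 0 * P i) = X by apply/funext => i; rewrite mul0r addr0.
have := LGdel (fun i => h * P i); rewrite tinnerZr tnormZ add0r (mulrC _ h) => /(_ _)/le_trans.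
apply; first by rewrite (le_lt_trans hP) // -ltr_pdivlMr.
by rewrite mulrAC ler_pdivrMr // -mulrA ler_wpM2l // ltW.
Qed.

(** Each entry moves with velocity minus the inner product of the gradient and [P j], by uniqueness
    of derivatives; the squares then sum to the pairing with [F]. The index maps [p] and [q] let
    rows and columns share one argument. *)
Lemma sqnorm_flow (T : {set {set 'I_N}}) (Rk : {set 'I_N} -> nat)
    (L : tensor R D -> R) G (Wt : R -> weights R N) (t : R)
    (mu : {set 'I_N}) n (p q : 'I_n -> nat) (P : 'I_n -> tensor R D) F :
  has_gradient L G -> gradient_flow D T Rk L Wt -> 0 <= t -> mu \in T ->
  (forall j, (p j < nrows D Rk mu)%N) -> (forall j, (q j < ncols D T Rk mu)%N) ->
  (forall j s, end_tensor D T Rk (upd (Wt t) mu (p j) (q j) s) =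
     fun i => end_tensor D T Rk (Wt t) i + s * P j i) ->
  (forall i, F i = \sum_j Wt t mu (p j) (q j) * P j i) ->
  deriv_nonneg (fun u => \sum_j Wt u mu (p j) (q j) ^+ 2) t
    (- 2 * tinner (G (end_tensor D T Rk (Wt t))) F).
Proof.
move=> LG flow t0 muT pn qn updE FE.
have -> : F = fun i => \sum_j Wt t mu (p j) (q j) * P j i by exact/funext.
rewrite (tinner_sumr _ _ (fun j i => Wt t mu (p j) (q j) * P j i)) mulr_sumr.
apply: deriv_nonneg_sum => j; rewrite tinnerZr.
have [g []] := flow t t0 mu muT (p j) (q j) (pn j) (qn j).
rewrite /phi_H; under eq_fun do rewrite updE.
move=> phi_g.
have := @derive_val _ _ _ _ _ _ _
  (is_derive_gradient L G (end_tensor D T Rk (Wt t)) (P j) LG).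
rewrite (@derive_val _ _ _ _ _ _ _ phi_g) => -> /(deriv_nonnegX _ _ _ 2).
by rewrite expr1 => Wd; rewrite (_ : - 2 * _ = 2 * Wt t mu (p j) (q j) *
  - tinner (G (end_tensor D T Rk (Wt t))) (P j)) //; ring.
Qed.
End Gradient.

(** * Conservation of balancedness along the flow *)

Section Balance.
Context {R : realType} {N : nat} {D : 'I_N -> nat} {T : {set {set 'I_N}}}
  {Rk : {set 'I_N} -> nat}.

Lemma row_sqnorm_ge0 (W : weights R N) nu r : 0 <= row_sqnorm D T Rk W nu r.
Proof. by apply: sumr_ge0 => j _; exact: sqr_ge0. Qed.

(** A nested maximum dominates each of its terms, so if it is zero every gap vanishes. *)
Lemma unbalancedness0 (W : weights R N) nu r c :
  unbalancedness D T Rk W = 0 -> is_interior T nu -> (r < Rk nu)%N ->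
  c \in children T nu -> col_sqnorm D Rk W c r = row_sqnorm D T Rk W nu r.
Proof.
move=> W0 nuI rR cnu.
have cin : col_sqnorm D Rk W c r \in lc_sqnorms D T Rk W nu r.
  by rewrite inE; apply/orP; right; apply/mapP; exists c; rewrite ?mem_enum.
have rin : row_sqnorm D T Rk W nu r \in lc_sqnorms D T Rk W nu r by rewrite mem_head.
apply/eqP; rewrite -subr_eq0 -normr_le0 -W0 /unbalancedness.
pose gap3 mu a x := \big[Num.max/0]_(y <- lc_sqnorms D T Rk W mu a) `|x - y|.
pose gap2 mu a := \big[Num.max/0]_(x <- lc_sqnorms D T Rk W mu a) gap3 mu a x.
apply: le_trans (le_bigmax_cond 0 (fun mu => \big[Num.max/0]_(a < Rk mu) gap2 mu a) nuI).
apply: le_trans (le_bigmax 0 (fun a : 'I_(Rk nu) => gap2 nu a) (Ordinal rR)).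
apply: le_trans (le_bigmax_seq 0 _ xpredT (gap3 nu r) cin isT).
exact: (le_bigmax_seq 0 _ xpredT (fun y => `|col_sqnorm D Rk W c r - y|) rin isT).
Qed.

Context {L : tensor R D -> R} {G : tensor R D -> tensor R D} {Wt : R -> weights R N}.
Hypotheses (treeT : is_mode_tree T) (LG : has_gradient L G)
  (flow : gradient_flow D T Rk L Wt).

(** The coefficient 1 replaces the inverse of [sigma], which keeps the tensor meaningful where
    [sigma] vanishes. *)
Local Notation component nu r t :=
  (fun i => tens_ov D T Rk (Wt t) (Some (nu, r, 1)) N.+1 [set: 'I_N]%SET 0 i).

Lemma row_sqnorm_flow nu r t : is_interior T nu -> (r < Rk nu)%N -> 0 <= t ->
  deriv_nonneg (fun u => row_sqnorm D T Rk (Wt u) nu r) t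
    (- 2 * tinner (G (end_tensor D T Rk (Wt t))) (component nu r t)).
Proof.
move=> nuI rR t0; case/andP: (nuI) => nuT _.
have [P [updE PE]] := row_directions treeT (D := D) (Wt t) nu r nuI rR.
apply: (sqnorm_flow T Rk L G Wt t nu _ (fun=> r) (fun j => j) (fun j => P j)) => // j.
  by rewrite (nrows_interior (T := T)).
by move=> s; rewrite updE.
Qed.

Lemma col_sqnorm_flow nu c r t : is_interior T nu -> (r < Rk nu)%N ->
  c \in children T nu -> 0 <= t ->
  deriv_nonneg (fun u => col_sqnorm D Rk (Wt u) c r) t
    (- 2 * tinner (G (end_tensor D T Rk (Wt t))) (component nu r t)).
Proof.
move=> nuI rR cnu t0; have [cT _ _] := childP cnu.
have [P [updE PE]] := col_directions treeT (D := D) (Wt t) nu c r nuI rR cnu.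
apply: (sqnorm_flow T Rk L G Wt t c _ (fun j => j) (fun=> r) (fun j => P j)) => // j.
  by rewrite (ncols_child treeT nu).
by move=> s; rewrite updE.
Qed.

Lemma balanced_flow nu c r t : unbalancedness D T Rk (Wt 0) = 0 ->
  is_interior T nu -> (r < Rk nu)%N -> c \in children T nu -> 0 <= t ->
  col_sqnorm D Rk (Wt t) c r = row_sqnorm D T Rk (Wt t) nu r.
Proof.
move=> W0 nuI rR cnu t0; apply/eqP; rewrite -subr_eq0; apply/eqP.
rewrite (deriv_nonneg0_cst
  (fun u => col_sqnorm D Rk (Wt u) c r - row_sqnorm D T Rk (Wt u) nu r)) //.
  by rewrite (unbalancedness0 _ nu) // subrr.
move=> u u0; have := deriv_nonnegB _ _ _ _ _
  (col_sqnorm_flow nu c r u nuI rR cnu u0) (row_sqnorm_flow nu r u nuI rR u0).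
by rewrite subrr.
Qed.

Lemma sigma_balanced nu r t : unbalancedness D T Rk (Wt 0) = 0 ->
  is_interior T nu -> (r < Rk nu)%N -> 0 <= t ->
  sigma D T Rk (Wt t) nu r =
  Num.sqrt (row_sqnorm D T Rk (Wt t) nu r) ^+ #|children T nu|.+1.
Proof.
move=> W0 nuI rR t0; rewrite /sigma exprS; congr (_ * _).
rewrite -prodr_const; apply: eq_bigr => c cnu.
by rewrite (balanced_flow nu).
Qed.

(** A zero row kills every term of the expansion along row directions. *)
Lemma component_eq0 nu r t : is_interior T nu -> (r < Rk nu)%N ->
  row_sqnorm D T Rk (Wt t) nu r = 0 -> component nu r t = fun=> 0.
Proof.
move=> nuI rR row0; apply/funext => i.
have [P [_ ->]] := row_directions treeT (D := D) (Wt t) nu r nuI rR.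
apply: big1 => b _; suff -> : Wt t nu r b = 0 by rewrite mul0r.
apply/eqP; rewrite -sqrf_eq0; apply/eqP.
by apply: (psumr_eq0P _ row0) => // j _; exact: sqr_ge0.
Qed.
End Balance.

(** The exponents multiply to [2 * n]. The right side keeps a factor [z ^+ n.+1], the value of
    [sigma] for [z] the root of the common squared norm, to cancel the normalization of
    [E_tensor]. *)
Lemma powR_two_sub (R : realType) (z : R) n : 0 < z ->
  (z ^+ n.+1) `^ (2 - 2 / n.+1%:R) = z ^+ n.+1 * z ^+ n / z.
Proof.
move=> z0; rewrite -[in LHS](powR_mulrn _ (ltW z0)) -powRrM.
have -> : n.+1%:R * (2 - 2 / n.+1%:R) = (n + n)%:R :> R.
  by rewrite mulrBr mulrCA divff ?pnatr_eq0 // -natr1 natrD; ring.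
rewrite powR_mulrn ?ltW // exprS exprD; field.
by rewrite gt_eqF.
Qed.

Theorem theorem1 (R : realType) (N : nat) (D : 'I_N -> nat)
  (T : {set {set 'I_N}}) (Rk : {set 'I_N} -> nat)
  (L : tensor R D -> R) (gradL : tensor R D -> tensor R D)
  (Wt : R -> weights R N) :
  is_mode_tree T ->
  (forall n, (0 < D n)%N) ->
  (forall nu, is_interior T nu -> (0 < Rk nu)%N) ->
  (forall X, 0 <= L X) ->
  has_gradient L gradL ->
  locally_lipschitz gradL ->
  gradient_flow D T Rk L Wt ->
  unbalancedness D T Rk (Wt 0) = 0 ->
  forall nu, is_interior T nu -> forall r : nat, (r < Rk nu)%N ->
  forall t : R, 0 <= t ->
    let Lnu := (#|children T nu|.+1)%N in
    deriv_nonneg (fun u => sigma D T Rk (Wt u) nu r) t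
      (sigma D T Rk (Wt t) nu r `^ (2 - 2 / Lnu%:R) * Lnu%:R *
       tinner (fun i => - gradL (end_tensor D T Rk (Wt t)) i)
              (E_tensor D T Rk (Wt t) nu r)).
Proof.
move=> treeT _ _ _ LG _ flow W0 nu nuI r rR t t0 Lnu.
pose q u := row_sqnorm D T Rk (Wt u) nu r.
have q_ge0 u : 0 <= u -> 0 <= q u by move=> _; exact: row_sqnorm_ge0.
have sigmaE u : 0 <= u -> sigma D T Rk (Wt u) nu r = Num.sqrt (q u) ^+ Lnu.
  exact: (sigma_balanced treeT LG flow).
apply: (deriv_nonneg_eq (fun u => Num.sqrt (q u) ^+ Lnu)) => // [u /sigmaE//|].
have qd : deriv_nonneg q t _ := row_sqnorm_flow treeT LG flow nu r t nuI rR t0.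
have [qt0|/negPf qt_neq0] := eqVneq (q t) 0.
  (* Here [sigma] is 0, so [E_tensor] is 0 by convention and the claimed rate is 0. *)
  rewrite (_ : _ * tinner _ _ = 0); last first.
    rewrite /tinner big1 ?mulr0 // => i _.
    by rewrite /E_tensor sigmaE // qt0 sqrtr0 expr0n eqxx mulr0.
  (* The existence of a child exhibits the exponent as [n.+2]. *)
  rewrite /Lnu -(prednK (interior_children treeT nu nuI)).
  apply: deriv_nonneg_sqrtX0 => //; move: qd; rewrite component_eq0 //.
  by rewrite /tinner big1 ?mulr0 // => i _; rewrite mulr0.
have qt_gt0 : 0 < q t by rewrite lt_def qt_neq0 q_ge0.
have s_gt0 : 0 < Num.sqrt (q t) by rewrite sqrtr_gt0.
have sigma_gt0 : 0 < sigma D T Rk (Wt t) nu r by rewrite sigmaE // exprn_gt0.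
have EE : E_tensor D T Rk (Wt t) nu r = fun i => (sigma D T Rk (Wt t) nu r)^-1 *
    tens_ov D T Rk (Wt t) (Some (nu, r, 1)) N.+1 [set: 'I_N]%SET 0 i.
  by apply/funext => i; rewrite /E_tensor gt_eqF // override_scale.
have -> : sigma D T Rk (Wt t) nu r `^ (2 - 2 / Lnu%:R) =
    sigma D T Rk (Wt t) nu r * Num.sqrt (q t) ^+ Lnu.-1 / Num.sqrt (q t).
  by rewrite sigmaE // powR_two_sub.
(* To be used with [y] as [sigma], [z] as the root of [q t], [w] as its power [Lnu.-1], [l] as
   [Lnu%:R], and [x] as the pairing of the gradient with the component. *)
have rate (l x y w z : R) : 0 < y -> 0 < z ->
    y * w / z * l * (y^-1 * - x) = l * w * (- 2 * x / (2 * z)).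
  by move=> y0 z0; field; rewrite !gt_eqF.
have := deriv_nonnegX _ _ _ Lnu (deriv_nonneg_sqrt q t _ qt_gt0 q_ge0 qd).
rewrite EE tinnerZr tinnerNl.
by rewrite -(rate _ _ _ _ _ sigma_gt0 s_gt0).
Qed.
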